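(* Let $n\ge1$, let $\mathcal E$ be an exact category and let $\mathcal X=\operatorname{add}\mathcal X$ be a subcategory of $\mathcal E$ satisfying $\operatorname{Ext}^i_{\mathcal E}(\mathcal X,\mathcal X)=0$ for $1\le i\le n$. Then the following are equivalent. (1) $\mathcal X$ is an $(n+1)$ cluster tilting subcategory of $\mathcal E$. (2) Every $E\in\mathcal E$ admits admissible exact sequences $$0\to E\to X^0\to X^1\to\cdots\to X^n\to0$$ and $$0\to X_n\to\cdots\to X_1\to X_0\to E\to0$$ with all terms $X^i,X_i$ in $\mathcal X$. More precisely, the first family of sequences exists for every $E\in\mathcal E$ if and only if $\mathcal X$ is strongly covariantly finite and $\Sigma_{\mathcal X}^n\cong\mathbf 0$. Dually, the second family exists for every $E\in\mathcal E$ if and only if $\mathcal X$ is strongly contravariantly finite and $\Omega_{\mathcal X}^n\cong\mathbf 0$.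
   Context: Subcategories are full and closed under isomorphisms; $\mathcal X=\operatorname{add}\mathcal X$ means that $\mathcal X$ is closed under finite direct sums and direct summands. $\operatorname{Ext}^i_{\mathcal E}$ denotes the extension groups of the exact category $\mathcal E$, and $\operatorname{Ext}^i_{\mathcal E}(\mathcal X,\mathcal X)=0$ means $\operatorname{Ext}^i_{\mathcal E}(X,X')=0$ for all $X,X'\in\mathcal X$. An admissible exact sequence is a sequence obtained by splicing conflations (the short exact sequences of the exact structure). A left $\mathcal X$-approximation of $A$ is a morphism $A\to X_A$ with $X_A\in\mathcal X$ through which every morphism from $A$ to an object of $\mathcal X$ factors; right $\mathcal X$-approximations are defined dually. $\mathcal X$ is functorially finite if every object of $\mathcal E$ admits both a left and a right $\mathcal X$-approximation. $\mathcal X$ is strongly covariantly finite if each $A\in\mathcal E$ admits a conflation $0\to A\to X_A\to A^+\to0$ with $X_A\in\mathcal X$ whose first morphism is a left $\mathcal X$-approximation; it is strongly contravariantly finite if each $A\in\mathcal E$ admits a conflation $0\to A^-\to X^A\to A\to0$ with $X^A\in\mathcal X$ whose second morphism is a right $\mathcal X$-approximation. An $(n+1)$ cluster tilting subcategory is a functorially finite subcategory $\mathcal X=\operatorname{add}\mathcal X$ satisfying $$\mathcal X=\{A\in\mathcal E\mid \operatorname{Ext}^i_{\mathcal E}(A,X)=0\text{ for all }X\in\mathcal X,\ 1\le i\le n\}=\{A\in\mathcal E\mid \operatorname{Ext}^i_{\mathcal E}(X,A)=0\text{ for all }X\in\mathcal X,\ 1\le i\le n\}.$$ (When $\mathcal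 E$ has enough projectives and injectives, these equalities force all projectives and injectives to lie in $\mathcal X$, so that $\mathcal X$ is generating and cogenerating and the definition agrees with the usual convention for exact categories.) $\mathcal E/[\mathcal X]$ is the ideal quotient of $\mathcal E$ by the morphisms factoring through objects of $\mathcal X$, with quotient functor $\pi_{\mathcal X}$. If $\mathcal X$ is strongly covariantly finite, the canonical suspension $\Sigma_{\mathcal X}$ is the endofunctor of $\mathcal E/[\mathcal X]$ induced by chosen left approximation conflations: $\Sigma_{\mathcal X}(\pi_{\mathcal X}A)=\pi_{\mathcal X}(A^+)$, and on morphisms one completes $f\colon A\to B$ to a morphism $(f,g,h)$ of the chosen conflations and takes $\pi_{\mathcal X}h$; this is well defined and independent of choices up to natural isomorphism. If $\mathcal X$ is strongly contravariantly finite, the canonical loop $\Omega_{\mathcal X}$ is defined dually, with $\Omega_{\mathcal X}(\pi_{\mathcal X}A)=\pi_{\mathcal X}(A^-)$. $\mathbf 0$ denotes the zero endofunctor of $\mathcal E/[\mathcal X]$.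
   Formalization: In (1)⇔(2), condition (1) additionally requires X to be generating and cogenerating, since (1)⇒(2) fails for general exact categories; when E has enough projectives and injectives, the equivalence is stated with the definition of cluster tilting unchanged. *)

(* Defs.v *)
From HB Require Import structures.
From mathcomp Require Import all_boot all_algebra.
From mathcomp Require Import boolp.
From Stdlib Require Import Relation_Operators.

Set Implicit Arguments.
Unset Strict Implicit.
Unset Printing Implicit Defensive.

Import GRing.Theory.
Local Open Scope ring_scope.
Local Open Scope quotient_scope.

Record preadditive := Preadditive {
  obj :> Type;
  hom : obj -> obj -> zmodType;
  idm : forall A, hom A A;
  comp : forall A B C, hom B C -> hom A B -> hom A C;
  comp1m : forall A B (f : hom A B), comp (idm B) f = f;
  compm1 : forall A B (f : hom A B), comp f (idm A) = f;
  compA : forall A B C D (h : hom C D) (g : hom B C) (f : hom A B),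
    comp h (comp g f) = comp (comp h g) f;
  compDl : forall A B C (g g' : hom B C) (f : hom A B),
    comp (g + g') f = comp g f + comp g' f;
  compDr : forall A B C (g : hom B C) (f f' : hom A B),
    comp g (f + f') = comp g f + comp g f'
}.

Arguments hom {p} A B : rename.
Arguments idm {p} A : rename.
Arguments comp {p A B C} g f : rename.

Notation "g '\c' f" := (comp g f) (at level 40, left associativity).

Section PreadditiveDefs.
Variable C : preadditive.
Implicit Types A B S : C.

Definition is_iso A B (f : hom A B) : Prop :=
  exists g : hom B A, g \c f = idm A /\ f \c g = idm B.

Definition is_zero A : Prop := idm A = 0.

Definition is_biproduct A B S : Prop :=
  exists (i1 : hom A S) (i2 : hom B S) (p1 : hom S A) (p2 : hom S B),
    [/\ p1 \c i1 = idm A, p2 \c i2 = idm B, p1 \c i2 = 0, p2 \c i1 = 0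
      & i1 \c p1 + i2 \c p2 = idm S].

Definition is_kernel A B D (u : hom A B) (p : hom B D) : Prop :=
  p \c u = 0 /\
  forall T (f : hom T B), p \c f = 0 -> exists! g : hom T A, u \c g = f.

Definition is_cokernel A B D (u : hom A B) (p : hom B D) : Prop :=
  p \c u = 0 /\
  forall T (f : hom B T), f \c u = 0 -> exists! g : hom D T, g \c p = f.

Definition is_pushout A B A' B' (u : hom A B) (f : hom A A')
    (f' : hom B B') (u' : hom A' B') : Prop :=
  f' \c u = u' \c f /\
  forall T (b : hom B T) (a : hom A' T), b \c u = a \c f ->
    exists! t : hom B' T, t \c f' = b /\ t \c u' = a.

Definition is_pullback B D B' D' (p : hom B D) (f : hom D' D)
    (f' : hom B' B) (p' : hom B' D') : Prop :=
  p \c f' = f \c p' /\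
  forall T (b : hom T B) (d : hom T D'), p \c b = f \c d ->
    exists! t : hom T B', f' \c t = b /\ p' \c t = d.

End PreadditiveDefs.

Section Inflations.
Variables (C : preadditive)
  (conf : forall A B D : C, hom A B -> hom B D -> Prop).

Definition inflation_for A B (u : hom A B) : Prop :=
  exists (D : C) (p : hom B D), conf u p.

Definition deflation_for B D (p : hom B D) : Prop :=
  exists (A : C) (u : hom A B), conf u p.

End Inflations.

(* Additive category with an exact structure in the sense of Quillen. *)
Record exact_category := ExactCategory {
  ecat :> preadditive;
  zobj : ecat;
  zobjP : is_zero zobj;
  biproducts : forall A B : ecat, exists S, is_biproduct A B S;
  conflation : forall A B D : ecat, hom A B -> hom B D -> Prop;
  conflation_ker : forall A B D (u : hom A B) (p : hom B D),
    conflation u p -> is_kernel u p;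
  conflation_coker : forall A B D (u : hom A B) (p : hom B D),
    conflation u p -> is_cokernel u p;
  conflation_iso : forall A B D A' B' D' (u : hom A B) (p : hom B D)
      (u' : hom A' B') (p' : hom B' D')
      (a : hom A A') (b : hom B B') (d : hom D D'),
    is_iso a -> is_iso b -> is_iso d ->
    b \c u = u' \c a -> d \c p = p' \c b ->
    conflation u p -> conflation u' p';
  inflation_id : forall A, inflation_for conflation (idm A);
  deflation_id : forall A, deflation_for conflation (idm A);
  inflation_comp : forall A B D (u : hom A B) (v : hom B D),
    inflation_for conflation u -> inflation_for conflation v ->
    inflation_for conflation (v \c u);
  deflation_comp : forall A B D (p : hom A B) (q : hom B D),
    deflation_for conflation p -> deflation_for conflation q ->
    deflation_for conflation (q \c p);
  inflation_pushout : forall A B A' (u : hom A B) (f : hom A A'),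
    inflation_for conflation u ->
    exists B' (f' : hom B B') (u' : hom A' B'),
      is_pushout u f f' u' /\ inflation_for conflation u';
  deflation_pullback : forall B D D' (p : hom B D) (f : hom D' D),
    deflation_for conflation p ->
    exists B' (f' : hom B' B) (p' : hom B' D'),
      is_pullback p f f' p' /\ deflation_for conflation p'
}.

Arguments zobj : clear implicits.
Arguments conflation {e A B D} u p : rename.

Notation inflation := (inflation_for (@conflation _)).
Notation deflation := (deflation_for (@conflation _)).

Section Projectives.
Variable E : exact_category.

Definition projective (P : E) : Prop :=
  forall (B D : E) (p : hom B D), deflation p ->
  forall f : hom P D, exists g : hom P B, f = p \c g.

Definition injective_obj (I : E) : Prop :=
  forall (A B : E) (u : hom A B), inflation u ->
  forall f : hom A I, exists g : hom B I, f = g \c u.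

Definition enough_projectives : Prop :=
  forall A : E, exists (P : E) (p : hom P A), projective P /\ deflation p.

Definition enough_injectives : Prop :=
  forall A : E, exists (I : E) (u : hom A I), injective_obj I /\ inflation u.

End Projectives.

Section Extensions.
Variable E : exact_category.

Record conflation_between (B A : E) := ConflationBetween {
  cmid : E;
  cinf : hom B cmid;
  cdef : hom cmid A;
  cconf : conflation cinf cdef
}.

(* [admseq m B A] is the type of admissible exact sequences
     0 -> B -> M_0 -> M_1 -> ... -> M_m -> A -> 0,
   i.e. m+1 spliced conflations; mind the shift. *)
Fixpoint admseq (m : nat) (B A : E) : Type :=
  match m with
  | 0 => conflation_between B A
  | m'.+1 => {K : E & (conflation_between B K * admseq m' K A)%type}
  end.

Fixpoint middle_terms_in (X : E -> Prop) (m : nat) (B A : E) :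
    admseq m B A -> Prop :=
  match m with
  | 0 => fun c => X (cmid c)
  | m'.+1 => fun s => X (cmid (projT2 s).1) /\
                      middle_terms_in X (projT2 s).2
  end.

(* There is a morphism of sequences with end components b and a. *)
Definition conflation_mor (B A B' A' : E) (c : conflation_between B A)
    (c' : conflation_between B' A') (b : hom B B') (a : hom A A') : Prop :=
  exists e : hom (cmid c) (cmid c'),
    e \c cinf c = cinf c' \c b /\ a \c cdef c = cdef c' \c e.

Fixpoint admseq_mor (m : nat) (B A B' A' : E) :
    admseq m B A -> admseq m B' A' -> hom B B' -> hom A A' -> Prop :=
  match m with
  | 0 => fun c c' b a => conflation_mor c c' b a
  | m'.+1 => fun s s' b a =>
      exists k : hom (projT1 s) (projT1 s'),
        conflation_mor (projT2 s).1 (projT2 s').1 b k /\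
        admseq_mor (projT2 s).2 (projT2 s').2 k a
  end.

Definition yoneda_equiv (m : nat) (B A : E) : admseq m B A -> admseq m B A ->
    Prop :=
  clos_refl_sym_trans _ (fun s s' => admseq_mor s s' (idm B) (idm A)).

(* Underlying set of Yoneda's Ext^i(A, B), for i >= 1: the classes of
   admissible exact sequences 0 -> B -> M_1 -> ... -> M_i -> A -> 0.
   The value at i = 0 is junk. *)
Definition Ext (i : nat) (A B : E) : Type :=
  {cl : admseq i.-1 B A -> Prop | exists s, cl = yoneda_equiv s}.

(* A group is zero iff it has a single element, so the Baer sum is not
   needed. *)
Definition Ext_vanishes (i : nat) (A B : E) : Prop :=
  forall x y : Ext i A B, x = y.

End Extensions.

(* Full subcategories X = add X; [add_summand] asks for closure under
   summands that have a complement in E. *)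
Record add_subcat (E : exact_category) := AddSubcat {
  add_mem :> E -> Prop;
  add_iso : forall A B (f : hom A B), is_iso f -> add_mem A -> add_mem B;
  add_zero : add_mem (zobj E);
  add_sum : forall A B S, is_biproduct A B S ->
    add_mem A -> add_mem B -> add_mem S;
  add_summand : forall A B S, is_biproduct A B S -> add_mem S -> add_mem A
}.

Section Approximations.
Variables (E : exact_category) (X : add_subcat E).

Definition left_approx (A XA : E) (u : hom A XA) : Prop :=
  X XA /\ forall (Y : E) (f : hom A Y), X Y -> exists g, f = g \c u.

Definition right_approx (XA A : E) (p : hom XA A) : Prop :=
  X XA /\ forall (Y : E) (f : hom Y A), X Y -> exists g, f = p \c g.

Definition functorially_finite : Prop :=
  (forall A : E, exists (XA : E) (u : hom A XA), left_approx u) /\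
  (forall A : E, exists (XA : E) (p : hom XA A), right_approx p).

Definition cluster_tilting (n : nat) : Prop :=
  [/\ functorially_finite,
      forall A : E, X A <->
        (forall B i, X B -> (1 <= i <= n)%N -> Ext_vanishes i A B)
    & forall A : E, X A <->
        (forall B i, X B -> (1 <= i <= n)%N -> Ext_vanishes i B A)].

Definition generating : Prop :=
  forall A : E, exists (Y : E) (p : hom Y A), X Y /\ deflation p.

Definition cogenerating : Prop :=
  forall A : E, exists (Y : E) (u : hom A Y), X Y /\ inflation u.

Record left_approx_conflation (A : E) := LeftApproxConflation {
  lac_mid : E;
  cosyz : E;
  lac_inf : hom A lac_mid;
  lac_def : hom lac_mid cosyz;
  lac_conf : conflation lac_inf lac_def;
  lac_approx : left_approx lac_inf
}.

Record right_approx_conflation (A : E) := RightApproxConflation {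
  rac_mid : E;
  syz : E;
  rac_inf : hom syz rac_mid;
  rac_def : hom rac_mid A;
  rac_conf : conflation rac_inf rac_def;
  rac_approx : right_approx rac_def
}.

Definition strongly_covariantly_finite : Prop :=
  forall A : E, inhabited (left_approx_conflation A).

Definition strongly_contravariantly_finite : Prop :=
  forall A : E, inhabited (right_approx_conflation A).

(* For n >= 1: 0 -> A -> X^0 -> ... -> X^n -> 0 with all X^i in X. *)
Definition has_coresolution (n : nat) (A : E) : Prop :=
  exists (Xn : E) (s : admseq n.-1 A Xn), X Xn /\ middle_terms_in X s.

(* For n >= 1: 0 -> X_n -> ... -> X_0 -> A -> 0 with all X_i in X. *)
Definition has_resolution (n : nat) (A : E) : Prop :=
  exists (Xn : E) (s : admseq n.-1 Xn A), X Xn /\ middle_terms_in X s.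

End Approximations.

Section PreadditiveFacts.
Variable C : preadditive.
Implicit Types A B D : C.

Lemma comp0m A B D (f : hom A B) : (0 : hom B D) \c f = 0.
Proof. by apply: (addrI (0 \c f)); rewrite -compDl !addr0. Qed.

Lemma compm0 A B D (g : hom B D) : g \c (0 : hom A B) = 0.
Proof. by apply: (addrI (g \c 0)); rewrite -compDr !addr0. Qed.

Lemma compNm A B D (g : hom B D) (f : hom A B) : (- g) \c f = - (g \c f).
Proof. by apply: (addrI (g \c f)); rewrite -compDl !subrr comp0m. Qed.

Lemma compmN A B D (g : hom B D) (f : hom A B) : g \c (- f) = - (g \c f).
Proof. by apply: (addrI (g \c f)); rewrite -compDr !subrr compm0. Qed.

Lemma compBl A B D (g g' : hom B D) (f : hom A B) :
  (g - g') \c f = g \c f - g' \c f.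
Proof. by rewrite compDl compNm. Qed.

Lemma compBr A B D (g : hom B D) (f f' : hom A B) :
  g \c (f - f') = g \c f - g \c f'.
Proof. by rewrite compDr compmN. Qed.

End PreadditiveFacts.

Section IdealQuotient.
Variables (E : exact_category) (X : add_subcat E).
Implicit Types A B D : E.

Definition factors A B (f : hom A B) : Prop :=
  exists (Y : E) (a : hom A Y) (b : hom Y B), X Y /\ f = b \c a.

Definition ideal A B : {pred hom A B} := [pred f | `[< factors f >]].
Arguments ideal A B : clear implicits.

Lemma idealP A B (f : hom A B) : reflect (factors f) (f \in ideal A B).
Proof. by rewrite inE; exact: asboolP. Qed.

Lemma ideal_zmod A B : zmod_closed (ideal A B).
Proof.
split=> [|f g /idealP[Y [a [b [XY ->]]]] /idealP[Z [c [d [XZ ->]]]]].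
  apply/idealP; exists (zobj E), 0, 0; split; first exact: add_zero.
  by rewrite comp0m.
apply/idealP; have [S bS] := biproducts Y Z.
have XS := add_sum bS XY XZ.
case: bS => i1 [i2 [p1 [p2 [e11 e22 e12 e21 _]]]].
exists S, (i1 \c a + i2 \c c), (b \c p1 - d \c p2); split=> //.
rewrite compDr !compBl -!compA (compA p1 i1) (compA p2 i1) (compA p1 i2).
by rewrite (compA p2 i2) e11 e12 e21 e22 !comp1m !comp0m !compm0 subr0 sub0r.
Qed.

HB.instance Definition _ A B :=
  GRing.isZmodClosed.Build (hom A B) (ideal A B) (@ideal_zmod A B).

Definition qhom A B : zmodType := Quotient.quot (ideal A B).

Definition qpi A B (f : hom A B) : qhom A B := \pi_(Quotient.quot (ideal A B)) f.

Definition qrepr A B (f : qhom A B) : hom A B := repr f.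

Lemma qreprK A B (f : qhom A B) : qpi (qrepr f) = f.
Proof. exact: reprK. Qed.

Lemma qpiP A B (f g : hom A B) : qpi f = qpi g <-> factors (f - g).
Proof.
have e : (f - g \in ideal A B) = (qpi f == qpi g) := Quotient.idealrBE _ f g.
split=> [fg|/idealP fg]; first by apply/idealP; rewrite e; apply/eqP.
by apply/eqP; rewrite -e.
Qed.

Lemma qpiD A B (f g : hom A B) : qpi (f + g) = qpi f + qpi g.
Proof. by rewrite /qpi raddfD. Qed.

Definition qcomp A B D (g : qhom B D) (f : qhom A B) : qhom A D :=
  qpi (qrepr g \c qrepr f).

Lemma qpi_comp A B D (g : hom B D) (f : hom A B) :
  qcomp (qpi g) (qpi f) = qpi (g \c f).
Proof.
have /qpiP[Y [a [b [XY eg]]]] := qreprK (qpi g).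
have /qpiP[Z [c [d [XZ ef]]]] := qreprK (qpi f).
rewrite /qcomp; set g' := qrepr _ in eg *; set f' := qrepr _ in ef *.
transitivity (qpi (g' \c f)); apply/qpiP.
  by exists Z, c, (g' \c d); rewrite -compBr ef compA.
by exists Y, (a \c f), b; rewrite -compBl eg compA.
Qed.

Lemma qcomp1m A B (f : qhom A B) : qcomp (qpi (idm B)) f = f.
Proof. by rewrite -(qreprK f) qpi_comp comp1m. Qed.

Lemma qcompm1 A B (f : qhom A B) : qcomp f (qpi (idm A)) = f.
Proof. by rewrite -(qreprK f) qpi_comp compm1. Qed.

Lemma qcompA A B D F (h : qhom D F) (g : qhom B D) (f : qhom A B) :
  qcomp h (qcomp g f) = qcomp (qcomp h g) f.
Proof.
by rewrite -(qreprK h) -(qreprK g) -(qreprK f) !qpi_comp compA.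
Qed.

Lemma qcompDl A B D (g g' : qhom B D) (f : qhom A B) :
  qcomp (g + g') f = qcomp g f + qcomp g' f.
Proof.
rewrite -(qreprK g) -(qreprK g') -(qreprK f) -qpiD !qpi_comp compDl.
exact: qpiD.
Qed.

Lemma qcompDr A B D (g : qhom B D) (f f' : qhom A B) :
  qcomp g (f + f') = qcomp g f + qcomp g f'.
Proof.
rewrite -(qreprK g) -(qreprK f) -(qreprK f') -qpiD !qpi_comp compDr.
exact: qpiD.
Qed.

(* E/[X]; its quotient functor is the identity on objects and [qpi] on
   morphisms. *)
Definition ideal_quotient : preadditive :=
  @Preadditive E qhom (fun A => qpi (idm A)) qcomp
    qcomp1m qcompm1 qcompA qcompDl qcompDr.

End IdealQuotient.

Record functor (C D : preadditive) := Functor {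
  fobj :> C -> D;
  fmap : forall A B : C, hom A B -> hom (fobj A) (fobj B);
  fmap1 : forall A : C, fmap (idm A) = idm (fobj A);
  fmap_comp : forall (A B F : C) (g : hom B F) (f : hom A B),
    fmap (g \c f) = fmap g \c fmap f
}.

Arguments fmap {C D} f {A B} _ : rename.

Section Functors.
Variable C : preadditive.

Definition id_functor : functor C C :=
  @Functor C C id (fun A B f => f) (fun=> erefl) (fun _ _ _ _ _ => erefl).

Lemma comp_functor_subproof1 (G F : functor C C) (A : C) :
  fmap G (fmap F (idm A)) = idm (G (F A)).
Proof. by rewrite !fmap1. Qed.

Lemma comp_functor_subproof2 (G F : functor C C) (A B D : C)
  (g : hom B D) (f : hom A B) :
  fmap G (fmap F (g \c f)) = fmap G (fmap F g) \c fmap G (fmap F f).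
Proof. by rewrite !fmap_comp. Qed.

Definition comp_functor (G F : functor C C) : functor C C :=
  Functor (comp_functor_subproof1 G F) (@comp_functor_subproof2 G F).

Fixpoint functor_pow (F : functor C C) (n : nat) : functor C C :=
  if n is n'.+1 then comp_functor F (functor_pow F n') else id_functor.

Definition const_functor (Z : C) : functor C C :=
  @Functor C C (fun=> Z) (fun _ _ _ => idm Z) (fun=> erefl)
    (fun _ _ _ _ _ => esym (comp1m (idm Z))).

Definition nat_iso (F G : functor C C) : Prop :=
  exists eta : forall A : C, hom (F A) (G A),
    (forall A, is_iso (eta A)) /\
    (forall (A B : C) (f : hom A B), eta B \c fmap F f = fmap G f \c eta A).

End Functors.

Section Suspension.
Variables (E : exact_category) (X : add_subcat E).
Variable c : forall A : E, left_approx_conflation X A.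
Notation Q := (ideal_quotient X).
Notation up A := (cosyz (c A)).

Definition susp_completes (A B : E) (f : hom A B) (h : hom (up A) (up B)) : Prop :=
  exists g : hom (lac_mid (c A)) (lac_mid (c B)),
    g \c lac_inf (c A) = lac_inf (c B) \c f /\
    h \c lac_def (c A) = lac_def (c B) \c g.

Lemma susp_completion A B (f : hom A B) : exists h, susp_completes f h.
Proof.
have [XB _] := lac_approx (c B); have [_ ap] := lac_approx (c A).
have [g eg] := ap _ (lac_inf (c B) \c f) XB.
have [_ /(_ _ (lac_def (c B) \c g))[]] := conflation_coker (lac_conf (c A)).
  rewrite -compA -eg compA.
  by have [-> _] := conflation_ker (lac_conf (c B)); rewrite comp0m.
by move=> h [eh _]; exists h, g.
Qed.

Lemma susp_completes_uniq A B (f f' : hom A B) h h' :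
  susp_completes f h -> susp_completes f' h' ->
  qpi X f = qpi X f' -> qpi X h = qpi X h'.
Proof.
move=> [g [eg eh]] [g' [eg' eh']] /qpiP[Z [a [b [XZ eab]]]].
have [XB _] := lac_approx (c B); have [_ ap] := lac_approx (c A).
have [a' ea] := ap _ a XZ.
have [kA uA] := conflation_coker (lac_conf (c A)).
have [kB _] := conflation_coker (lac_conf (c B)).
pose v := g - g' - lac_inf (c B) \c (b \c a').
have v0 : v \c lac_inf (c A) = 0.
  by rewrite !compBl eg eg' -!compA -ea -eab compBr subrr.
have [s [es _]] := uA _ _ v0.
apply/qpiP; exists (lac_mid (c B)), s, (lac_def (c B)); split=> //.
have [|t [_ ut]] := uA _ ((h - h') \c lac_def (c A)).
  by rewrite -compA kA compm0.
rewrite -(ut (h - h') erefl); apply: ut.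
by rewrite -compA es !compBr compBl eh eh'
  (compA (lac_def (c B)) (lac_inf _)) kB comp0m subr0.
Qed.

Definition susp_map (A B : E) (f : @hom Q A B) : @hom Q (up A) (up B) :=
  qpi X (projT1 (cid (susp_completion (qrepr f)))).

Lemma susp_mapE A B (f : hom A B) h :
  susp_completes f h -> susp_map (qpi X f) = qpi X h.
Proof.
rewrite /susp_map; case: cid => h' /= ch' ch.
by apply: susp_completes_uniq ch' ch _; rewrite qreprK.
Qed.

Lemma susp_map1 (A : Q) : susp_map (idm A) = @idm Q (up A).
Proof. by apply: susp_mapE; exists (idm _); rewrite !comp1m !compm1. Qed.

Lemma susp_map_comp (A B D : Q) (g : hom B D) (f : hom A B) :
  susp_map (g \c f) = (susp_map g : @hom Q (up B) (up D)) \c susp_map f.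
Proof.
have [h ch] := susp_completion (qrepr g).
have [k ck] := susp_completion (qrepr f).
rewrite -[in RHS](qreprK g) -[in RHS](qreprK f) (susp_mapE ch) (susp_mapE ck).
rewrite [RHS]qpi_comp; apply: susp_mapE.
have [[h' [e1 e2]] [k' [e3 e4]]] := (ch, ck).
exists (h' \c k'); split; first by rewrite -compA e3 !compA e1.
by rewrite -compA e4 !compA e2.
Qed.

(* [susp_mapE] says that pi f is sent to pi h for every completion
   (f, g, h). *)
Definition suspension_for : functor Q Q :=
  @Functor Q Q (fun A => up A) susp_map susp_map1 susp_map_comp.

End Suspension.

Section Loop.
Variables (E : exact_category) (X : add_subcat E).
Variable c : forall A : E, right_approx_conflation X A.
Notation Q := (ideal_quotient X).
Notation down A := (syz (c A)).

Definition loop_completes (A B : E) (f : hom A B) (h : hom (down A) (down B)) : Prop :=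
  exists g : hom (rac_mid (c A)) (rac_mid (c B)),
    f \c rac_def (c A) = rac_def (c B) \c g /\
    g \c rac_inf (c A) = rac_inf (c B) \c h.

Lemma loop_completion A B (f : hom A B) : exists h, loop_completes f h.
Proof.
have [XA _] := rac_approx (c A); have [_ ap] := rac_approx (c B).
have [g eg] := ap _ (f \c rac_def (c A)) XA.
have [_ /(_ _ (g \c rac_inf (c A)))[]] := conflation_ker (rac_conf (c B)).
  rewrite compA -eg -compA.
  by have [-> _] := conflation_ker (rac_conf (c A)); rewrite compm0.
by move=> h [eh _]; exists h, g.
Qed.

Lemma loop_completes_uniq A B (f f' : hom A B) h h' :
  loop_completes f h -> loop_completes f' h' ->
  qpi X f = qpi X f' -> qpi X h = qpi X h'.
Proof.
move=> [g [eg eh]] [g' [eg' eh']] /qpiP[Z [a [b [XZ eab]]]].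
have [XA _] := rac_approx (c A); have [_ ap] := rac_approx (c B).
have [b' eb] := ap _ b XZ.
have [kB uB] := conflation_ker (rac_conf (c B)).
have [kA _] := conflation_ker (rac_conf (c A)).
pose v := g - g' - (b' \c a) \c rac_def (c A).
have v0 : rac_def (c B) \c v = 0.
  by rewrite !compBr -eg -eg' !compA -eb -eab compBl subrr.
have [s [es _]] := uB _ _ v0.
apply/qpiP; exists (rac_mid (c A)), (rac_inf (c A)), s; split=> //.
have [|t [_ ut]] := uB _ (rac_inf (c B) \c (h - h')).
  by rewrite compA kB comp0m.
rewrite -(ut (h - h') erefl); apply: ut.
by rewrite compA es !compBl compBr eh eh'
  -(compA _ (rac_def (c A))) kA compm0 subr0.
Qed.

Definition loop_map (A B : E) (f : @hom Q A B) : @hom Q (down A) (down B) :=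
  qpi X (projT1 (cid (loop_completion (qrepr f)))).

Lemma loop_mapE A B (f : hom A B) h :
  loop_completes f h -> loop_map (qpi X f) = qpi X h.
Proof.
rewrite /loop_map; case: cid => h' /= ch' ch.
by apply: loop_completes_uniq ch' ch _; rewrite qreprK.
Qed.

Lemma loop_map1 (A : Q) : loop_map (idm A) = @idm Q (down A).
Proof. by apply: loop_mapE; exists (idm _); rewrite !comp1m !compm1. Qed.

Lemma loop_map_comp (A B D : Q) (g : hom B D) (f : hom A B) :
  loop_map (g \c f) = (loop_map g : @hom Q (down B) (down D)) \c loop_map f.
Proof.
have [h ch] := loop_completion (qrepr g).
have [k ck] := loop_completion (qrepr f).
rewrite -[in RHS](qreprK g) -[in RHS](qreprK f) (loop_mapE ch) (loop_mapE ck).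
rewrite [RHS]qpi_comp; apply: loop_mapE.
have [[h' [e1 e2]] [k' [e3 e4]]] := (ch, ck).
exists (h' \c k'); split; first by rewrite -compA e3 !compA e1.
by rewrite -compA e4 !compA e2.
Qed.

Definition loop_for : functor Q Q :=
  @Functor Q Q (fun A => down A) loop_map loop_map1 loop_map_comp.

End Loop.

Section CanonicalFunctors.
Variables (E : exact_category) (X : add_subcat E).

Definition suspension (hX : strongly_covariantly_finite X) :
    functor (ideal_quotient X) (ideal_quotient X) :=
  suspension_for (fun A => inhabited_witness (hX A)).

Definition loop (hX : strongly_contravariantly_finite X) :
    functor (ideal_quotient X) (ideal_quotient X) :=
  loop_for (fun A => inhabited_witness (hX A)).

Definition zero_functor : functor (ideal_quotient X) (ideal_quotient X) :=
  @const_functor (ideal_quotient X) (zobj E).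

End CanonicalFunctors.

(* Main.v *)
From mathcomp Require Import all_boot all_algebra boolp zify.
From Stdlib Require Import Relation_Operators.
Require Import Defs.

(** The claims split into two dual halves. The arguments about resolutions are
applied to the opposite exact category to treat coresolutions; reversing
admissible exact sequences identifies the extension groups of the two
categories ([Ext_vanishes_dual]).

The homological input is dimension shifting in the second argument of the
extension groups. Since these are defined by zigzags of morphisms of sequences,
one first needs a usable criterion for a sequence to be trivial. View a sequence
from [L] to [A] as a resolution of [A], and let a map from [L] to [Z] be null
([ext_null]) if on some refinement of the resolution it extends to the first
middle term. Two refinements have a common one on which the two maps to the
original resolution are homotopic ([refine_common]), so nullity is invariant
under Yoneda equivalence, and the extension group vanishes if and only if every
map is null for every resolution ([Ext_vanishes_null]). In this form the
relevant parts of the long exact sequence ([Ext_shift_end], [Ext_shift_start])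
are short diagram chases, because refining the resolution of [A] does not touch
the second argument.

Let [X] be rigid up to degree [n], and let [A] have a resolution of length [n]
by objects of [X]. Shifting along it shows that extensions of degree one of
objects of [X] by the first syzygy are extensions by the last term of the
resolution in a degree at most [n], and so vanish: the resolution consists of
right approximations ([resolved_right_approx]). Its last syzygy lies in [X], and
syzygies are determined up to stable isomorphism, so the [n]-th power of the loop
functor is zero. Conversely, splicing the chosen approximation conflations gives
a sequence whose last syzygy is stably zero, hence in [X] ([resolvedP]).

If [A] is moreover orthogonal to [X], meaning that its extensions by objects of
[X] vanish in degrees [1] to [n], then the same shifting shows that the
conflation ending in [A] splits, so [A] lies in [X]
([resolved_ext_orthogonal]). Conversely, when [X] is cluster tilting and
generating, approximations can be made deflations
([generating_approx_conflation]), and each approximation conflation makes its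
kernel orthogonal in one more degree, so that the [n]-th kernel lies in [X]
([resolved_of_approx]). With enough projectives and injectives, these lie in a
cluster tilting [X] by orthogonality, so [X] is generating and cogenerating. *)

Set Implicit Arguments.
Unset Strict Implicit.
Unset Printing Implicit Defensive.

Import GRing.Theory.

(** * Conflations *)

Section ConflationFacts.
Local Open Scope ring_scope.
Variable E : exact_category.
Implicit Types A B D K L M N R T : E.

Lemma is_iso_idm A : is_iso (idm A).
Proof. by exists (idm A); rewrite comp1m. Qed.

Lemma cdef_inf A B (c : conflation_between B A) : cdef c \c cinf c = 0.
Proof. by have [] := conflation_ker (cconf c). Qed.

Lemma cinf_lift A B (c : conflation_between B A) T (f : hom T (cmid c)) :
  cdef c \c f = 0 -> exists g, f = cinf c \c g.
Proof.
by have [_ ker] := conflation_ker (cconf c); case/ker=> g [<- _]; exists g.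
Qed.

Lemma cinf_mono A B (c : conflation_between B A) T (g g' : hom T B) :
  cinf c \c g = cinf c \c g' -> g = g'.
Proof.
have [_ ker] := conflation_ker (cconf c) => eg.
have [|h [_ uh]] := ker T (cinf c \c g'); first by rewrite compA cdef_inf comp0m.
by rewrite -(uh g eg) -(uh g').
Qed.

Lemma cdef_extend A B (c : conflation_between B A) T (f : hom (cmid c) T) :
  f \c cinf c = 0 -> exists g, f = g \c cdef c.
Proof.
by have [_ cok] := conflation_coker (cconf c); case/cok=> g [<- _]; exists g.
Qed.

Lemma cdef_epi A B (c : conflation_between B A) T (g g' : hom A T) :
  g \c cdef c = g' \c cdef c -> g = g'.
Proof.
have [_ cok] := conflation_coker (cconf c) => eg.
have [|h [_ uh]] := cok T (g' \c cdef c); first by rewrite -compA cdef_inf compm0.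
by rewrite -(uh g eg) -(uh g').
Qed.

Lemma cdef_deflation A B (c : conflation_between B A) : deflation (cdef c).
Proof. by exists B, (cinf c); exact: cconf. Qed.

Lemma cinf_inflation A B (c : conflation_between B A) : inflation (cinf c).
Proof. by exists A, (cdef c); exact: cconf. Qed.

Lemma deflation_lift M K (p : hom M K) R (g : hom R K) : deflation p ->
  exists Q (q : hom Q R) (b : hom Q M), deflation q /\ p \c b = g \c q.
Proof.
move=> dp; have [Q [b [q [[e _] dq]]]] := deflation_pullback g dp.
by exists Q, q, b.
Qed.

Lemma conflation_kernel B B' M A (v : hom B M) (u : hom B' M) (p : hom M A) :
  conflation v p -> is_kernel u p -> conflation u p.
Proof.
move=> cf [pu keru]; pose c := ConflationBetween cf.
have [i ei] : exists i, u = v \c i by exact: (@cinf_lift _ _ c).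
have [j [ej _]] : exists! j, u \c j = v by apply: keru; exact: (cdef_inf c).
have ij : i \c j = idm B.
  by apply: (@cinf_mono _ _ c) => /=; rewrite compA -ei ej compm1.
have ji : j \c i = idm B'.
  have [k [_ uk]] := keru _ u pu.
  by rewrite -(uk (j \c i)) ?compA ?ej -?ei // (uk (idm B')) ?compm1.
apply: (@conflation_iso _ _ _ _ _ _ _ v p u p j (idm M) (idm A)) => //;
  try exact: is_iso_idm.
- by exists i.
- by rewrite comp1m ej.
- by rewrite comp1m compm1.
Qed.

(** The axioms provide a pullback of the deflation together with some kernel of
it; the universal property makes [B] itself a kernel, so that the pulled back
conflation starts at [B] on the nose. *)
Lemma conflation_pull A B (c : conflation_between B A) A' (f : hom A' A) :
  exists c' : conflation_between B A', conflation_mor c' c (idm B) f.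
Proof.
have [Q [f' [p' [[e univ] [K [v cf]]]]]] :=
  deflation_pullback f (cdef_deflation c).
have [|u [[fu pu] _]] := univ B (cinf c) 0; first by rewrite compm0 cdef_inf.
suff cu : conflation u p'.
  by exists (ConflationBetween cu), f'; rewrite /= compm1.
apply: conflation_kernel cf _; split=> // T g pg.
have [g1 eg1] : exists g1, f' \c g = cinf c \c g1.
  by apply: cinf_lift; rewrite compA e -compA pg compm0.
have [|h [_ uh]] := univ T (f' \c g) (p' \c g); first by rewrite !compA e.
have ug1 : u \c g1 = g.
  rewrite -(uh g) // -(uh (u \c g1)) //.
  by rewrite !compA fu pu eg1 pg comp0m.
exists g1; split=> // g2 eg2; apply: (@cinf_mono _ _ c).
by rewrite -fu -!compA eg2 ug1.
Qed.

Lemma split_biproduct A B (c : conflation_between B A) (j : hom A (cmid c)) :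
  cdef c \c j = idm A ->
  exists r : hom (cmid c) B,
    [/\ r \c cinf c = idm B, r \c j = 0
      & cinf c \c r + j \c cdef c = idm (cmid c)].
Proof.
move=> dj; have [r er] : exists r, idm (cmid c) - j \c cdef c = cinf c \c r.
  by apply: cinf_lift; rewrite compBr compm1 compA dj comp1m subrr.
exists r; split; last by rewrite -er subrK.
- apply: (@cinf_mono _ _ c).
  by rewrite compA -er compBl -compA cdef_inf compm0 subr0 comp1m compm1.
- apply: (@cinf_mono _ _ c).
  by rewrite compA -er compBl -compA dj comp1m compm1 subrr compm0.
Qed.

(** Every pair of objects has a split conflation: the trivial conflation
[B = B -> 0], pulled back along [A -> 0]. *)
Lemma split_conflation B A : exists (c : conflation_between B A)
  (r : hom (cmid c) B) (j : hom A (cmid c)),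
  [/\ r \c cinf c = idm B, cdef c \c j = idm A, r \c j = 0
    & cinf c \c r + j \c cdef c = idm (cmid c)].
Proof.
have [D [p cf]] := inflation_id B; pose c0 := ConflationBetween cf.
have [c [e [e1 _]]] := conflation_pull c0 (0 : hom A D).
rewrite /= compm1 in e1.
have [j ej] : exists j, idm (cmid c) - cinf c \c e = j \c cdef c.
  by apply: cdef_extend; rewrite compBl comp1m -compA e1 compm1 subrr.
have dj : cdef c \c j = idm A.
  apply: (@cdef_epi _ _ c).
  by rewrite -compA -ej compBr compA cdef_inf comp0m subr0 compm1 comp1m.
have [r [r1 r2 r3]] := split_biproduct dj.
by exists c, r, j.
Qed.

(** Both this lemma and its converse rest on the fact that a morphism of
conflations is null homotopic at one end if and only if it is at the other.
In terms of extensions: the pushout of [c'] along [b] is the pullback of [c]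
along [a], and either condition says that it splits. *)
Lemma lift_of_extension A B A' B' (c' : conflation_between B' A')
    (c : conflation_between B A) (b : hom B' B) (a : hom A' A) w :
  conflation_mor c' c b a -> b = w \c cinf c' ->
  exists j : hom A' (cmid c), cdef c \c j = a.
Proof.
move=> [e [e1 e2]] eb.
have [j ej] : exists j, e - cinf c \c w = j \c cdef c'.
  by apply: cdef_extend; rewrite compBl e1 eb compA subrr.
exists j; apply: (@cdef_epi _ _ c').
by rewrite -compA -ej compBr compA cdef_inf comp0m subr0 e2.
Qed.

Lemma extension_of_lift A B A' B' (c' : conflation_between B' A')
    (c : conflation_between B A) (b : hom B' B) (a : hom A' A) j :
  conflation_mor c' c b a -> a = cdef c \c j ->
  exists w : hom (cmid c') B, b = w \c cinf c'.
Proof.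
move=> [e [e1 e2]] ea.
have [w ew] : exists w, e - j \c cdef c' = cinf c \c w.
  by apply: cinf_lift; rewrite compBr -e2 compA -ea subrr.
exists w; apply: (@cinf_mono _ _ c).
by rewrite compA -ew compBl e1 -compA cdef_inf compm0 subr0.
Qed.

Lemma conflation_mor_comp A B A' B' A2 B2 (c : conflation_between B A)
    (c' : conflation_between B' A') (c2 : conflation_between B2 A2) b a b' a' :
  conflation_mor c c' b a -> conflation_mor c' c2 b' a' ->
  conflation_mor c c2 (b' \c b) (a' \c a).
Proof.
move=> [e [e1 e2]] [f [f1 f2]]; exists (f \c e).
by rewrite -!compA e1 e2 !compA f1 f2.
Qed.

Lemma conflation_mor_id A B (c : conflation_between B A) :
  conflation_mor c c (idm B) (idm A).
Proof. by exists (idm _); rewrite !comp1m !compm1. Qed.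

(** Maps out of the middle term lift through a deflation once the middle term
is replaced by a pullback; the right end is unchanged because deflations
compose. *)
Lemma conflation_refine A B (c : conflation_between B A) M K (p : hom M K)
    (h : hom (cmid c) K) : deflation p ->
  exists B' (c' : conflation_between B' A) (b : hom B' B)
    (g : hom (cmid c') M),
    conflation_mor c' c b (idm A) /\ h \c cinf c \c b = p \c g \c cinf c'.
Proof.
move=> dp; have [Q [q [g [dq eg]]]] := deflation_lift h dp.
have [B' [v cf]] := deflation_comp dq (cdef_deflation c).
have [b eb] : exists b, q \c v = cinf c \c b.
  by apply: cinf_lift; rewrite compA; exact: (cdef_inf (ConflationBetween cf)).
exists B', (ConflationBetween cf), b, g; split; last by rewrite /= eg -!compA eb.
by exists q; rewrite /= comp1m.
Qed.

(** One step of the comparison of two refinements. The hypothesis says that the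
two maps into the right end [D] agree up to homotopy, and the conclusion says
the same one place further to the left. *)
Lemma conflation_common L D L1 D1 L2 D2 R1
    (c : conflation_between L D) (c1 : conflation_between L1 D1)
    (c2 : conflation_between L2 D2) k1 d1 k2 d2
    (l1 : hom R1 D1) (l2 : hom R1 D2) (h : hom R1 (cmid c)) :
  conflation_mor c1 c k1 d1 -> conflation_mor c2 c k2 d2 ->
  d1 \c l1 - d2 \c l2 = cdef c \c h ->
  exists R (r : conflation_between R R1) a1 a2 w,
    [/\ conflation_mor r c1 a1 l1, conflation_mor r c2 a2 l2
      & k1 \c a1 - k2 \c a2 = w \c cinf r].
Proof.
move=> [e1 [i1 p1]] [e2 [i2 p2]] eh.
have [Q1 [q1 [b1 [dq1 eb1]]]] := deflation_lift l1 (cdef_deflation c1).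
have [Q2 [q2 [b2 [dq2 eb2]]]] := deflation_lift (l2 \c q1) (cdef_deflation c2).
have [R [v cf]] := deflation_comp dq2 dq1; pose r := ConflationBetween cf.
have qv : q1 \c q2 \c v = 0 := cdef_inf r.
have [a1 ea1] : exists a1, b1 \c q2 \c v = cinf c1 \c a1.
  by apply: cinf_lift; rewrite !compA eb1 -!compA (compA q1) qv compm0.
have [a2 ea2] : exists a2, b2 \c v = cinf c2 \c a2.
  by apply: cinf_lift; rewrite !compA eb2 -!compA (compA q1) qv compm0.
have [w ew] : exists w,
    e1 \c (b1 \c q2) - e2 \c b2 - h \c (q1 \c q2) = cinf c \c w.
  apply: cinf_lift; rewrite !compBr !compA -p1 -p2 -eh -!compA eb2.
  by rewrite (compA _ b1) eb1 -!compA compBl -!compA !compA subrr.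
exists R, r, a1, a2, w; split.
- by exists (b1 \c q2); rewrite /= ea1 !compA eb1.
- by exists b2; rewrite /= ea2 !compA eb2.
apply: (@cinf_mono _ _ c); rewrite [RHS]compA -ew !compBl -!compA /=.
rewrite (compA b1) ea1 ea2 (compA q1) qv compm0 subr0.
by rewrite compBr !compA i1 i2.
Qed.

End ConflationFacts.

(** * The opposite exact category *)

Section Dual.
Local Open Scope ring_scope.

Definition dual_preadditive (C : preadditive) : preadditive :=
  @Preadditive C (fun A B => @hom C B A) (fun A => idm A)
    (fun A B D g f => f \c g)
    (fun A B f => compm1 f) (fun A B f => comp1m f)
    (fun A B D F h g f => esym (compA f g h))
    (fun A B D g g' f => compDr f g g') (fun A B D g f f' => compDl f f' g).

Variable E : exact_category.
Notation op := (dual_preadditive E).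

Lemma dual_is_biproduct (A B S : E) :
  is_biproduct A B S -> is_biproduct (C := op) A B S.
Proof.
by move=> [i1 [i2 [p1 [p2 [h1 h2 h3 h4 h5]]]]]; exists p1, p2, i1, i2.
Qed.

Lemma undual_is_biproduct (A B S : E) :
  is_biproduct (C := op) A B S -> is_biproduct A B S.
Proof.
by move=> [i1 [i2 [p1 [p2 [h1 h2 h3 h4 h5]]]]]; exists p1, p2, i1, i2.
Qed.

Definition dual_conflation (A B D : op) (u : hom A B) (p : hom B D) : Prop :=
  @conflation E D B A p u.

Lemma dual_biproducts (A B : op) : exists S, is_biproduct A B S.
Proof.
by have [S bS] := @biproducts E A B; exists S; apply: dual_is_biproduct.
Qed.

Lemma invert_square (C : preadditive) (A B A' B' : C) (u : hom A B)
    (u' : hom A' B') (a : hom A' A) (b : hom B' B) (a' : hom A A')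
    (b' : hom B B') :
  a \c a' = idm A -> b' \c b = idm B' -> u \c a = b \c u' ->
  b' \c u = u' \c a'.
Proof.
move=> aa bb e.
by rewrite -[LHS]compm1 -aa -compA (compA u) e -compA compA bb comp1m.
Qed.

Lemma dual_conflation_iso (A B D A' B' D' : op) (u : hom A B) (p : hom B D)
    (u' : hom A' B') (p' : hom B' D')
    (a : hom A A') (b : hom B B') (d : hom D D') :
  is_iso a -> is_iso b -> is_iso d ->
  b \c u = u' \c a -> d \c p = p' \c b ->
  dual_conflation u p -> dual_conflation u' p'.
Proof.
move=> [a' [a1 a2]] [b' [b1 b2]] [d' [d1 d2]] eu ep.
apply: (@conflation_iso E _ _ _ _ _ _ p u p' u' d' b' a').
- by exists d.
- by exists b.
- by exists a.
- exact: (@invert_square E _ _ _ _ p p' d b d' b').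
- exact: (@invert_square E _ _ _ _ u u' b a b' a').
Qed.

Lemma dual_inflation_comp (A B D : op) (u : hom A B) (v : hom B D) :
  inflation_for dual_conflation u -> inflation_for dual_conflation v ->
  inflation_for dual_conflation (v \c u).
Proof. by move=> du dv; apply: (@deflation_comp E) dv du. Qed.

Lemma dual_deflation_comp (A B D : op) (p : hom A B) (q : hom B D) :
  deflation_for dual_conflation p -> deflation_for dual_conflation q ->
  deflation_for dual_conflation (q \c p).
Proof. by move=> du dv; apply: (@inflation_comp E) dv du. Qed.

Definition dual : exact_category :=
  @ExactCategory op (zobj E) (@zobjP E) dual_biproducts dual_conflation
    (fun A B D u p cf => @conflation_coker E D B A p u cf)
    (fun A B D u p cf => @conflation_ker E D B A p u cf)
    dual_conflation_iso (@deflation_id E) (@inflation_id E)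
    dual_inflation_comp dual_deflation_comp
    (fun A B A' u f du => @deflation_pullback E B A A' u f du)
    (fun B D D' p f dp => @inflation_pushout E D B D' p f dp).

Definition dual_subcat (X : add_subcat E) : add_subcat dual :=
  @AddSubcat dual (fun A => X A)
    (fun A B f fi XA => let: ex_intro g (conj h1 h2) := fi in
       @add_iso E X A B g (ex_intro _ f (conj h1 h2)) XA)
    (@add_zero E X)
    (fun A B S bS => @add_sum E X A B S (undual_is_biproduct bS))
    (fun A B S bS => @add_summand E X A B S (undual_is_biproduct bS)).

Definition dual_conf (A B : E) (c : conflation_between B A) :
    @conflation_between dual A B :=
  @ConflationBetween dual A B (cmid c) (cdef c) (cinf c) (cconf c).

Definition undual_conf (A B : E) (c : @conflation_between dual A B) :
    conflation_between B A :=
  @ConflationBetween E B A (cmid c) (cdef c) (cinf c) (cconf c).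

Lemma dual_confK (A B : E) (c : conflation_between B A) :
  undual_conf (dual_conf c) = c.
Proof. by case: c. Qed.

Lemma undual_confK (A B : E) (c : @conflation_between dual A B) :
  dual_conf (undual_conf c) = c.
Proof. by case: c. Qed.

End Dual.

(** * Reversing admissible exact sequences *)

Section Snoc.
Variable E : exact_category.
Implicit Types A B K : E.

(** The sequences grow at their left end; splicing at the right end is what
reversal needs. *)
Fixpoint snoc m B K A :
    admseq m B K -> conflation_between K A -> admseq m.+1 B A :=
  match m return admseq m B K -> conflation_between K A -> admseq m.+1 B A with
  | 0 => fun c d => existT _ K (c, d)
  | m'.+1 => fun s d => existT _ (projT1 s) ((projT2 s).1, snoc (projT2 s).2 d)
  end.

Lemma snoc_surj m B A (s : admseq m.+1 B A) :
  exists K (t : admseq m B K) (c : conflation_between K A), s = snoc t c.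
Proof.
elim: m B s => [|m IH] B [K [c s]]; first by exists K, c, s.
have [K' [t [d ->]]] := IH _ s.
by exists K', (existT _ K (c, t)), d.
Qed.

Lemma middle_terms_snoc (X : E -> Prop) m B K A (s : admseq m B K)
    (c : conflation_between K A) :
  middle_terms_in X (snoc s c) <-> middle_terms_in X s /\ X (cmid c).
Proof.
elim: m B s => [|m IH] B /=; first by move=> s; split.
by move=> [K' [d s]] /=; have /= -> := IH _ s; split=> [[? []] | [[]]].
Qed.

Lemma snoc_mor m B K A B' K' A' (s : admseq m B K) (c : conflation_between K A)
    (s' : admseq m B' K') (c' : conflation_between K' A') b k a :
  admseq_mor s s' b k -> conflation_mor c c' k a ->
  admseq_mor (snoc s c) (snoc s' c') b a.
Proof.
move=> ms mc; elim: m B B' s s' b ms => [|m IH] B B' s s' b /=.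
  by exists k.
by move=> [k' [md ms]]; exists k'; split=> //; apply: IH.
Qed.

End Snoc.

Section DualExt.
Variable E : exact_category.
Implicit Types A B : E.
Notation op := (dual E).

Fixpoint rev_adm m B A : @admseq E m B A -> @admseq op m A B :=
  match m return @admseq E m B A -> @admseq op m A B with
  | 0 => fun c => dual_conf c
  | m'.+1 => fun s => @snoc op m' A (projT1 s) B
               (rev_adm (projT2 s).2) (dual_conf (projT2 s).1)
  end.

Fixpoint unrev_adm m B A : @admseq op m A B -> @admseq E m B A :=
  match m return forall A, @admseq op m A B -> @admseq E m B A with
  | 0 => fun A c => undual_conf c
  | m'.+1 => fun A s => @snoc E m' B (projT1 s) A
               (unrev_adm (projT2 s).2) (undual_conf (projT2 s).1)
  end A.

Lemma rev_snoc m B K A (s : @admseq E m B K) (c : conflation_between K A) :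
  rev_adm (snoc s c) =
  existT (fun K0 => (@conflation_between op A K0 * @admseq op m K0 B)%type) K
    (dual_conf c, rev_adm s).
Proof.
elim: m B s => [|m IH] B //= [K' [d s]].
by move: (IH _ s) => /= ->.
Qed.

Lemma unrev_snoc m B K A (s : @admseq op m A K)
    (c : @conflation_between op K B) :
  unrev_adm (snoc s c) =
  existT (fun K0 => (@conflation_between E B K0 * @admseq E m K0 A)%type) K
    (undual_conf c, unrev_adm s).
Proof.
elim: m A s => [|m IH] A //= [K' [d s]].
by move: (IH _ s) => /= ->.
Qed.

Lemma unrev_admK m B A (s : @admseq op m A B) : rev_adm (unrev_adm s) = s.
Proof.
elim: m A s => [|m IH] A /=; first exact: undual_confK.
move=> [K [c s]].
by apply: etrans (rev_snoc (unrev_adm s) (undual_conf c)) _;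
  rewrite IH undual_confK.
Qed.

Lemma rev_admK m B A (s : @admseq E m B A) : unrev_adm (rev_adm s) = s.
Proof.
elim: m B s => [|m IH] B /=; first exact: dual_confK.
move=> [K [c s]].
by apply: etrans (unrev_snoc (rev_adm s) (dual_conf c)) _;
  rewrite IH dual_confK.
Qed.

Lemma rev_mor m B A B' A' (s : @admseq E m B A) (s' : @admseq E m B' A') b a :
  admseq_mor s s' b a ->
  @admseq_mor op m A' B' A B (rev_adm s') (rev_adm s) a b.
Proof.
elim: m B B' s s' b => [|m IH] B B' s s' b.
  by move=> [e [e1 e2]]; exists e; split; rewrite /= -?e1 -?e2.
move=> [k [[e [e1 e2]] ms]].
by apply: (snoc_mor (IH _ _ _ _ _ ms)); exists e; split; rewrite /= -?e1 -?e2.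
Qed.

Lemma unrev_mor m B A B' A' (s : @admseq op m A B) (s' : @admseq op m A' B')
    b a :
  @admseq_mor op m A B A' B' s s' a b ->
  admseq_mor (unrev_adm s') (unrev_adm s) b a.
Proof.
elim: m A A' s s' a => [|m IH] A A' s s' a.
  by move=> [e [e1 e2]]; exists e; split; rewrite /= -?e1 -?e2.
move=> [k [[e [e1 e2]] ms]].
by apply: (snoc_mor (IH _ _ _ _ _ ms)); exists e; split; rewrite /= -?e1 -?e2.
Qed.

(** Two Yoneda classes coincide exactly when their representatives are
equivalent, so a vanishing extension group is one whose sequences are all
equivalent to each other. *)
Lemma Ext_vanishesP (F : exact_category) i (A B : F) :
  Ext_vanishes i A B <-> forall s t : admseq i.-1 B A, yoneda_equiv s t.
Proof.
split=> [van s t|eqv [x [s es]] [y [t et]]].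
  have [e] := van (exist _ _ (ex_intro _ s erefl))
                  (exist _ _ (ex_intro _ t erefl)).
  by have: yoneda_equiv t t by [exact: rst_refl]; rewrite -e.
have exy : x = y.
  rewrite es et; apply/funext => r; apply/propext; split; apply: rst_trans.
    exact: eqv.
  exact: eqv.
by move: es; rewrite exy => es; congr exist; exact: Prop_irrelevance.
Qed.

Lemma yoneda_equiv_rev (F F' : exact_category) m (B A : F) (B' A' : F')
    (phi : admseq m B A -> admseq m B' A') :
  (forall s t, admseq_mor s t (idm B) (idm A) ->
     admseq_mor (phi t) (phi s) (idm B') (idm A')) ->
  forall s t, yoneda_equiv s t -> yoneda_equiv (phi s) (phi t).
Proof.
move=> phi_mor s t; elim=> [x y /phi_mor m_xy|x|x y _|x y z _ h1 _ h2].
- exact/rst_sym/rst_step.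
- exact: rst_refl.
- exact: rst_sym.
- exact: rst_trans h1 h2.
Qed.

(** Reversal is a bijection on sequences that turns morphisms around, hence it
preserves and reflects Yoneda equivalence. This lemma is what lets the results
below be proved on one side only. *)
Lemma Ext_vanishes_dual i A B :
  Ext_vanishes i A B <-> @Ext_vanishes op i B A.
Proof.
rewrite !Ext_vanishesP; split=> eqv s t.
  rewrite -(unrev_admK s) -(unrev_admK t).
  by apply: yoneda_equiv_rev (eqv _ _) => {}s {}t; exact: rev_mor.
rewrite -(rev_admK s) -(rev_admK t).
by apply: (@yoneda_equiv_rev op E) (eqv _ _) => {}s {}t; exact: unrev_mor.
Qed.

End DualExt.

(** * A criterion for the vanishing of Yoneda extensions *)

Section Vanishing.
Local Open Scope ring_scope.
Variable E : exact_category.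
Implicit Types A B D K L M R Z : E.

Definition first_mid m L A : admseq m L A -> E :=
  match m with
  | 0 => fun c => cmid c
  | m'.+1 => fun s => cmid (projT2 s).1
  end.

Definition first_inf m L A : forall t : admseq m L A, hom L (first_mid t) :=
  match m with
  | 0 => fun c => cinf c
  | m'.+1 => fun s => cinf (projT2 s).1
  end.

Definition admcons m B K A (c : conflation_between B K) (s : admseq m K A) :
    admseq m.+1 B A := existT _ K (c, s).

(** A sequence [t] from [L] to [A] and a map [f : L -> Z] give a class in the
extension group of [A] by [Z], namely the pushout of [t] along [f]. The class is
zero exactly when, after refining the resolution [t] of [A], the map [f] is
null homotopic; this is the description of extensions as the colimit, over all
resolutions of [A], of maps modulo homotopy. *)
Definition ext_null m L A Z (t : admseq m L A) (f : hom L Z) : Prop :=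
  exists L' (t' : admseq m L' A) (k : hom L' L) (w : hom (first_mid t') Z),
    admseq_mor t' t k (idm A) /\ f \c k = w \c first_inf t'.

Lemma first_inf_mor m L A L' A' (t : admseq m L A) (t' : admseq m L' A') k a :
  admseq_mor t t' k a ->
  exists e, e \c first_inf t = first_inf t' \c k.
Proof.
case: m t t' => [|m] t t' /=; first by move=> [e [e1 _]]; exists e.
by move=> [l [[e [e1 _]] _]]; exists e.
Qed.

Lemma admseq_mor_id m L A (t : admseq m L A) : admseq_mor t t (idm L) (idm A).
Proof.
elim: m L t => [|m IH] L t; first exact: conflation_mor_id.
by exists (idm _); split; [exact: conflation_mor_id | exact: IH].
Qed.

Lemma admseq_mor_comp m L A L' A' L2 A2 (t : admseq m L A)
    (t' : admseq m L' A') (t2 : admseq m L2 A2) k a k' a' :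
  admseq_mor t t' k a -> admseq_mor t' t2 k' a' ->
  admseq_mor t t2 (k' \c k) (a' \c a).
Proof.
elim: m L L' L2 t t' t2 k k' => [|m IH] L L' L2 t t' t2 k k' /=.
  exact: conflation_mor_comp.
move=> [l [ml mt]] [l' [ml' mt']]; exists (l' \c l); split.
  exact: conflation_mor_comp ml ml'.
exact: IH mt mt'.
Qed.

Lemma refinement_comp m L A L' L2 (t : admseq m L A)
    (t' : admseq m L' A) (t2 : admseq m L2 A) k k' :
  admseq_mor t t' k (idm A) -> admseq_mor t' t2 k' (idm A) ->
  admseq_mor t t2 (k' \c k) (idm A).
Proof. by move=> h1 h2; have := admseq_mor_comp h1 h2; rewrite comp1m. Qed.

Lemma refine_lift m R A (r : admseq m R A) M K (p : hom M K)
    (h : hom (first_mid r) K) : deflation p ->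
  exists R' (r' : admseq m R' A) (b : hom R' R) (g : hom (first_mid r') M),
    admseq_mor r' r b (idm A) /\
    h \c first_inf r \c b = p \c g \c first_inf r'.
Proof.
move=> dp; case: m r h => [|m] r h /=.
  by have [R' [c' [b [g [mc eg]]]]] := conflation_refine h dp; exists R', c', b, g.
case: r h => [K1 [c s]] /= h.
have [R' [c' [b [g [mc eg]]]]] := conflation_refine h dp.
exists R', (admcons c' s), b, g; split=> //=.
by exists (idm K1); split=> //; exact: admseq_mor_id.
Qed.

(** Resolutions of [A] and homotopy classes of maps over [A] form a filtered
system: two refinements of [t] have a common refinement on which the two maps
to [t] are homotopic. The homotopy is built from the right end towards the
left; before each step [refine_lift] makes the homotopy found so far lift to
the next middle term. *)
Lemma refine_common m L A (t : admseq m L A) L1 L2 (t1 : admseq m L1 A)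
    (t2 : admseq m L2 A) k1 k2 :
  admseq_mor t1 t k1 (idm A) -> admseq_mor t2 t k2 (idm A) ->
  exists R (r : admseq m R A) a1 a2 w,
    [/\ admseq_mor r t1 a1 (idm A), admseq_mor r t2 a2 (idm A)
      & k1 \c a1 - k2 \c a2 = w \c first_inf r].
Proof.
elim: m L L1 L2 t t1 t2 k1 k2 => [|m IH] L L1 L2 t t1 t2 k1 k2 /=.
  (* Both maps are the identity at A, so the homotopy starts as zero. *)
  move=> m1 m2; apply: (conflation_common (h := 0) m1 m2).
  by rewrite subrr compm0.
move=> [l1 [m1 n1]] [l2 [m2 n2]].
have [R [r [a1 [a2 [w [ma1 ma2 ew]]]]]] := IH _ _ _ _ _ _ _ _ n1 n2.
have [R' [r' [b [g [mb eg]]]]] := refine_lift w (cdef_deflation (projT2 t).1).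
have [|Q [q [b1 [b2 [v [mb1 mb2 ev]]]]]] :=
    conflation_common (l1 := a1 \c b) (l2 := a2 \c b) (h := g \c first_inf r')
      m1 m2.
  by rewrite !compA -compBl ew eg.
exists Q, (admcons q r'), b1, b2, v; split=> //=.
  by exists (a1 \c b); split=> //; exact: refinement_comp mb ma1.
by exists (a2 \c b); split=> //; exact: refinement_comp mb ma2.
Qed.

Lemma ext_null_of_refinement m A L L' Z (t : admseq m L A) (t' : admseq m L' A)
    k (f : hom L Z) :
  admseq_mor t' t k (idm A) -> ext_null t' (f \c k) -> ext_null t f.
Proof.
move=> mk [L2 [t2 [k2 [w [mk2 ew]]]]]; exists L2, t2, (k \c k2), w.
by split; [exact: refinement_comp mk2 mk | rewrite compA].
Qed.

(** Nullity does not depend on the refinement in which it is tested: a null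
homotopy found over one refinement moves to any other through a common one. *)
Lemma ext_null_refine m A L L' Z (t : admseq m L A) (t' : admseq m L' A)
    k (f : hom L Z) :
  admseq_mor t' t k (idm A) -> ext_null t f -> ext_null t' (f \c k).
Proof.
move=> mk [L2 [t2 [k2 [w [mk2 ew]]]]].
have [R [r [a1 [a2 [v [ma1 ma2 ev]]]]]] := refine_common mk mk2.
have [e ee] := first_inf_mor ma2.
exists R, r, a1, (f \c v + w \c e); split=> //.
by rewrite compDl -!compA -ev ee (compA w) -ew compBr -(compA f) subrK.
Qed.

Lemma ext_null_post m A L Z Z' (t : admseq m L A) (f : hom L Z) (g : hom Z Z') :
  ext_null t f -> ext_null t (g \c f).
Proof.
move=> [L' [t' [k [w [mk ew]]]]]; exists L', t', k, (g \c w).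
by rewrite -!compA ew.
Qed.

Lemma ext_null_lift m A L M K (p : hom M K) (t : admseq m L A) (f : hom L K) :
  deflation p -> ext_null t f ->
  exists L' (t' : admseq m L' A) (k : hom L' L) (w : hom (first_mid t') M),
    admseq_mor t' t k (idm A) /\ f \c k = p \c w \c first_inf t'.
Proof.
move=> dp [L' [t' [k [w [mk ew]]]]].
have [R' [r' [b [g [mb eg]]]]] := refine_lift w dp.
exists R', r', (k \c b), g; split; first exact: refinement_comp mb mk.
by rewrite compA ew.
Qed.

(** An equivalence is a zigzag of morphisms that fix both ends, and nullity
passes along each of them in both directions. *)
Lemma ext_null_yoneda m A Z (s s' : admseq m Z A) :
  yoneda_equiv s s' -> ext_null s (idm Z) <-> ext_null s' (idm Z).
Proof.
elim=> [x y mxy|x|x y _ [h1 h2]|x y z _ [h1 h2] _ [h3 h4]] //; last first.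
  by split=> ?; auto.
split=> h.
  by apply: (ext_null_of_refinement mxy); rewrite comp1m.
by have := ext_null_refine mxy h; rewrite comp1m.
Qed.

Lemma conflation_push A B (c : conflation_between B A) B' (f : hom B B') :
  exists c' : conflation_between B' A, conflation_mor c c' f (idm A).
Proof.
have [c' [e [e1 e2]]] := @conflation_pull (dual E) B A (dual_conf c) B' f.
by exists (undual_conf c'), e; split; rewrite /= -?e1 -?e2.
Qed.

Lemma admseq_push m A L Z (t : admseq m L A) (f : hom L Z) :
  exists s : admseq m Z A, admseq_mor t s f (idm A).
Proof.
case: m t => [|m] t; first exact: conflation_push.
have [c mc] := conflation_push (projT2 t).1 f.
exists (admcons c (projT2 t).2); exists (idm _); split=> //.
exact: admseq_mor_id.
Qed.

(** The sequence [0 -> ... -> 0 -> A = A] receives a map from every resolution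
of [A]. *)
Lemma zero_admseq m A : exists K (z : admseq m K A),
  forall L (t : admseq m L A), admseq_mor t z 0 (idm A).
Proof.
elim: m => [|m [K [z hz]]].
  have [K [u cf]] := deflation_id A; exists K, (ConflationBetween cf) => L t.
  by exists (cdef t); split; rewrite /= ?cdef_inf ?compm0.
have [K' [u cf]] := deflation_id K.
exists K', (admcons (ConflationBetween cf) z) => L [L1 [c t]] /=.
exists 0; split; last exact: hz.
by exists 0; split; rewrite /= ?comp0m ?compm0.
Qed.

(** The null sequence is the split conflation of [Z] by the left end of the
sequence of [zero_admseq] (in length one, by [A]). If [s] is null, pulling its
first conflation back along a refinement that witnesses this makes it split;
the resulting sequence maps to [s], and through the retraction to the null
sequence. *)
Lemma null_admseq m Z A : exists z : admseq m Z A,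
  ext_null z (idm Z) /\
  forall s : admseq m Z A, ext_null s (idm Z) -> yoneda_equiv s z.
Proof.
case: m => [|m].
  have [z [r [j [rz zj rj rzj]]]] := split_conflation Z A.
  exists z; split.
    by exists Z, z, (idm Z), r; rewrite comp1m rz; split=> //;
      exact: conflation_mor_id.
  move=> s [L' [t' [k [w [mk ew]]]]].
  have [i ei] : exists i, cdef s \c i = idm A.
    by apply: (lift_of_extension (w := w) mk); rewrite -[k]comp1m ew.
  apply/rst_sym/rst_step; exists (cinf s \c r + i \c cdef z).
  split; first by rewrite compDl -!compA rz cdef_inf compm0 addr0.
  by rewrite comp1m compDr !compA cdef_inf comp0m add0r ei comp1m.
have [K [z hz]] := zero_admseq m A.
have [c [r [_ [rc _ _ _]]]] := split_conflation Z K.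
exists (admcons c z); split.
  exists Z, (admcons c z), (idm Z), r; split; last by rewrite comp1m rc.
  exact: (admseq_mor_id (admcons c z)).
move=> s [L' [t' [b [w [[k [mc mk]] ew]]]]].
have [j ej] : exists j, cdef (projT2 s).1 \c j = k.
  by apply: (lift_of_extension (w := w) mc); rewrite -[b]comp1m ew.
(* Since k lifts to the middle term, c1 splits, with retraction r1. *)
have [c1 mc1] := conflation_pull (projT2 s).1 k.
have [r1 er1] := extension_of_lift mc1 (esym ej).
pose s1 : admseq m.+1 Z A := admcons c1 (projT2 t').2.
apply: (@rst_trans _ _ _ s1); last apply: rst_step.
  by apply/rst_sym/rst_step; exists k.
exists 0; split; last exact: hz.
exists (cinf c \c r1); split; first by rewrite -compA -er1.
by rewrite comp0m compA cdef_inf comp0m.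
Qed.

(** The tool for all computations of extension groups below. From left to
right, the pushout of [t] along [f] is equivalent to a null sequence; from
right to left, all sequences are equivalent to the same one. *)
Lemma Ext_vanishes_null m A Z :
  Ext_vanishes m.+1 A Z <->
  forall L (t : admseq m L A) (f : hom L Z), ext_null t f.
Proof.
have [z [z0 hz]] := null_admseq m Z A.
split=> [/Ext_vanishesP eqv L t f|null].
  have [s ms] := admseq_push t f.
  rewrite -[f]comp1m; apply: (ext_null_refine ms).
  exact/(ext_null_yoneda (eqv s z)).
apply/Ext_vanishesP => s t.
by apply: (@rst_trans _ _ _ z); [exact: hz | exact/rst_sym/hz].
Qed.

(** * Dimension shifting *)

Lemma Ext1_lift Y A B (c : conflation_between B A) (f : hom Y A) :
  Ext_vanishes 1 Y B -> exists j, f = cdef c \c j.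
Proof.
move/Ext_vanishes_null => van; have [d md] := conflation_pull c f.
have [L' [t' [k [w [mk]]]]] := van _ d (idm B); rewrite comp1m => ew.
have [|j ej] := lift_of_extension (w := w) (conflation_mor_comp mk md).
  by rewrite comp1m.
by exists j; rewrite ej compm1.
Qed.

(** The part of the long exact sequence at the extensions by [K]. A class by
[K] whose image under the connecting map is null lifts, on a refinement, to a
class by the middle term: this is [lift_of_extension] applied to the first
conflation of the refinement. *)
Lemma Ext_shift_end m A B K (c : conflation_between B K) :
  Ext_vanishes m.+1 A (cmid c) -> Ext_vanishes m.+2 A B ->
  Ext_vanishes m.+1 A K.
Proof.
move=> /Ext_vanishes_null vM /Ext_vanishes_null vB.
apply/Ext_vanishes_null => L t f.
(* The sequence that starts with d represents the image of the class under the
   connecting map. *)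
have [d md] := conflation_pull c f.
have [L' [t' [b [w [[k [mk mt]]]]]]] := vB _ (admcons d t) (idm B).
rewrite comp1m => ew.
have [j ej] : exists j, cdef c \c j = f \c k.
  apply: (lift_of_extension (w := w) (conflation_mor_comp mk md)).
  by rewrite comp1m.
apply: (ext_null_of_refinement mt); rewrite -ej.
by apply: ext_null_post; exact: vM.
Qed.

Lemma conflation_mor_of_mid A B A' B' (c' : conflation_between B' A')
    (c : conflation_between B A) (b : hom B' B) (e : hom (cmid c') (cmid c)) :
  e \c cinf c' = cinf c \c b ->
  exists a : hom A' A, conflation_mor c' c b a.
Proof.
move=> e1; have [a ea] : exists a, cdef c \c e = a \c cdef c'.
  by apply: cdef_extend; rewrite -compA e1 compA cdef_inf comp0m.
by exists a, e.
Qed.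

(** The part of the long exact sequence at the extensions by [B]. A null
homotopy of the image in the middle term induces a map [v] from the next syzygy
to [K], a class of one degree less; refining until [v] is null homotopic, with
the homotopy lifted to the middle term, corrects the given one to take values
in [B]. *)
Lemma Ext_shift_start m A B K (c : conflation_between B K) :
  Ext_vanishes m.+1 A K -> Ext_vanishes m.+2 A (cmid c) ->
  Ext_vanishes m.+2 A B.
Proof.
move=> /Ext_vanishes_null vK /Ext_vanishes_null vM.
apply/Ext_vanishes_null => L t f.
have [L' [[D [d t']] [k [w [mk ew]]]]] := vM _ t (cinf c \c f).
have [v mv] : exists v, conflation_mor d c (f \c k) v.
  by apply: (conflation_mor_of_mid (e := w)); rewrite compA -ew.
have [L2 [t2 [k2 [h [mk2 eh]]]]] :=
  ext_null_lift (cdef_deflation c) (vK _ t' v).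
have [d2 md2] := conflation_pull d k2.
have m2 : admseq_mor (admcons d2 t2) (admcons d t') (idm L') (idm A).
  by exists k2.
have [w2 ew2] := extension_of_lift (j := h \c first_inf t2)
  (conflation_mor_comp md2 mv) (etrans eh (esym (compA _ _ _))).
apply: (ext_null_of_refinement mk); apply: (ext_null_of_refinement m2).
exists L', (admcons d2 t2), (idm L'), w2; split; first exact: admseq_mor_id.
by rewrite compm1.
Qed.

(** The case of [Ext_shift_start] in lowest degree, where maps from [A] to [K]
play the part of the extensions by [K]. *)
Lemma Ext1_of_lift A B K (c : conflation_between B K) :
  (forall v : hom A K, exists j, v = cdef c \c j) ->
  Ext_vanishes 1 A (cmid c) -> Ext_vanishes 1 A B.
Proof.
move=> lft /Ext_vanishes_null vM; apply/Ext_vanishes_null => L t f.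
have [L' [d [k [w [mk ew]]]]] := vM _ t (cinf c \c f).
have [v mv] : exists v, conflation_mor d c (f \c k) v.
  by apply: (conflation_mor_of_mid (e := w)); rewrite compA -ew.
have [j ej] := lft v; have [w2 ew2] := extension_of_lift mv ej.
by exists L', d, k, w2.
Qed.

Lemma Ext_injective m A I : injective_obj I -> Ext_vanishes m.+1 A I.
Proof.
move=> injI; apply/Ext_vanishes_null => L t f.
have infl : inflation (first_inf t).
  by case: m t => [|m] t /=; exact: cinf_inflation.
have [w ew] := injI _ _ _ infl f.
exists L, t, (idm L), w; split; first exact: admseq_mor_id.
by rewrite compm1.
Qed.

End Vanishing.

(** * Finite resolutions by objects of a rigid subcategory *)

Section Resolutions.
Variables (E : exact_category) (X : add_subcat E).
Implicit Types A B D K L M R Y Z : E.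

(** Peeling a resolution off from its right end makes the syzygies of [A]
visible; the sequences themselves are built from the left. *)
Fixpoint resolved (m : nat) (A : E) : Prop :=
  if m is m'.+1 then
    exists K (c : conflation_between K A), X (cmid c) /\ resolved m' K
  else X A.

Lemma has_resolutionE m A : has_resolution X m.+1 A <-> resolved m.+1 A.
Proof.
rewrite /has_resolution /=; elim: m A => [|m IH] A.
  by split=> [[B [c [XB Xc]]]|[B [c [Xc XB]]]]; exists B, c.
split=> [[B [s [XB]]]|[K [c [Xc]]]].
  have [K [t [c ->]]] := snoc_surj s.
  move=> /middle_terms_snoc[Xt Xc]; exists K, c; split=> //.
  by apply/IH; exists B, t.
by move=> /IH[B [t [XB Xt]]]; exists B, (snoc t c); split=> //;
  apply/middle_terms_snoc.
Qed.

(** Each step of the resolution raises the degree by one, and the last syzygy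
lies in [X]. *)
Lemma Ext_resolved n Y :
  (forall B i, X B -> 1 <= i <= n -> Ext_vanishes i Y B) ->
  forall m K i, resolved m K -> 1 <= i -> i + m <= n -> Ext_vanishes i Y K.
Proof.
move=> van; elim=> [|m IH] K i /=.
  by move=> XK i1 iN; apply: van => //; rewrite i1 -(addn0 i).
move=> [K' [c [Xc rK']]] i1 iN; case: i i1 iN => // i _ iN.
apply: (Ext_shift_end (c := c)); first by apply: van => //; lia.
by apply: IH => //; lia.
Qed.

Lemma split_add_mem A B (c : conflation_between B A) (j : hom A (cmid c)) :
  cdef c \c j = idm A -> X (cmid c) -> X A.
Proof.
move=> dj; have [r [r1 r2 r3]] := split_biproduct dj.
apply: (@add_summand _ X A B); exists j, (cinf c), (cdef c), r; split=> //.
  exact: cdef_inf.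
by rewrite GRing.addrC.
Qed.

Definition rigid_upto (n : nat) : Prop :=
  forall (i : nat) (A B : E), 1 <= i <= n -> X A -> X B -> Ext_vanishes i A B.

Section Rigid.
Variable n : nat.
Hypothesis rigid : rigid_upto n.

(** The first syzygy [K] has a resolution of length [m], so extensions of
objects of [X] by [K] in degree one are extensions by an object of [X] in degree
[m.+1], which vanish. *)
Lemma resolved_right_approx m A K (c : conflation_between K A) :
  m < n -> X (cmid c) -> resolved m K -> right_approx X (cdef c).
Proof.
move=> mn Xc rK; split=> // Y f XY; apply: Ext1_lift.
apply: (@Ext_resolved n _ _ m) => // B i XB iN.
exact: rigid.
Qed.

Lemma resolved_contravariantly_finite : 0 < n ->
  (forall A, resolved n A) -> strongly_contravariantly_finite X.
Proof.
case: n resolved_right_approx => // m ap _ res A.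
have [K [c [Xc rK]]] := res A; constructor.
exact: RightApproxConflation (cconf c) (ap _ _ _ _ (ltnSn m) Xc rK).
Qed.

(** Here dimension shifting is applied with [A] in the first argument: the
conflation that ends in [A] splits. *)
Lemma resolved_ext_orthogonal A : 0 < n -> resolved n A ->
  (forall B i, X B -> 1 <= i <= n -> Ext_vanishes i A B) -> X A.
Proof.
case: n => // m _ [K [c [Xc rK]]] van.
have [|j ej] := Ext1_lift c (idm A).
  by apply: (@Ext_resolved m.+1 _ _ m).
exact: split_add_mem (esym ej) Xc.
Qed.

(** Each right approximation conflation kills one more degree of extensions
from [X]: lifting through the approximation handles degree one, and the higher
degrees are shifted from the previous syzygy. After [n] steps the syzygy is
orthogonal to [X] in all degrees up to [n]. *)
Lemma resolved_of_approx :
  strongly_contravariantly_finite X ->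
  (forall A, (forall B i, X B -> 1 <= i <= n -> Ext_vanishes i B A) -> X A) ->
  forall A, resolved n A.
Proof.
move=> scf orth.
suff res m A : m <= n ->
    (forall B i, X B -> 1 <= i -> i + m <= n -> Ext_vanishes i B A) ->
    resolved m A.
  by move=> A; apply: res => // B i _ i1; lia.
elim: m A => [|m IH] A mn van /=.
  by apply: orth => B i XB /andP[i1 iN]; apply: van => //; rewrite addn0.
have [ac] := scf A; pose c := ConflationBetween (rac_conf ac).
have [Xc lft] := rac_approx ac.
exists (syz ac), c; split=> //; apply: IH => [|B i XB i1 iN]; first exact: ltnW.
case: i i1 iN => // -[|i] _ iN.
  apply: (Ext1_of_lift (c := c)); first by move=> v; exact: lft.
  by apply: rigid => //; lia.
apply: (Ext_shift_start (c := c)); first by apply: van => //; lia.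
by apply: rigid => //; lia.
Qed.

End Rigid.

Section Syzygies.
Local Open Scope ring_scope.
Variable c : forall A : E, right_approx_conflation X A.
Notation down := (fun A : E => syz (c A)).

(** If the identity of [A] factors through an object of [X], then [A] is a
retract of that object, perhaps without a complement; but then the right
approximation of [A] splits too, and its kernel is a complement. *)
Lemma factors_right_approx_mem A (ac : right_approx_conflation X A) :
  factors X (idm A) -> X A.
Proof.
move=> [Y [a [b [XY eab]]]]; have [Xc lft] := rac_approx ac.
have [b' eb] := lft _ b XY.
apply: (split_add_mem (c := ConflationBetween (rac_conf ac)) (j := b' \c a)).
  by rewrite /= compA -eb eab.
exact: Xc.
Qed.

Lemma resolved_of_iter m A : X (iter m down A) -> resolved m A.
Proof.
elim: m A => // m IH A; rewrite iterSr => XA.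
exists (down A), (ConflationBetween (rac_conf (c A))).
by split; [have [] := rac_approx (c A) | exact: IH].
Qed.

(** Retracts in the quotient by the ideal of [X]. Retracts, rather than
isomorphisms, suffice to compare the syzygies of one object that come from
different approximations. *)
Definition stable_retract A B : Prop :=
  exists (f : hom A B) (g : hom B A), factors X (idm A - g \c f).

Lemma stable_retract_syzygy A B (a : right_approx_conflation X A)
    (b : right_approx_conflation X B) :
  stable_retract A B -> stable_retract (syz a) (syz b).
Proof.
move=> [f [g [Y [u [v [XY euv]]]]]].
pose ca := ConflationBetween (rac_conf a); have [Xa la] := rac_approx a.
have lifts C D (c1 : right_approx_conflation X C)
    (c2 : right_approx_conflation X D) (h : hom C D) :
    exists e h', rac_def c2 \c e = h \c rac_def c1 /\
      e \c rac_inf c1 = rac_inf c2 \c h'.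
  have [X1 _] := rac_approx c1; have [_ l2] := rac_approx c2.
  have [e ee] := l2 _ (h \c rac_def c1) X1.
  have [h' eh] := @cinf_lift _ _ _ (ConflationBetween (rac_conf c2)) _
    (e \c rac_inf c1) ltac:(by rewrite /= compA -ee -compA
      (cdef_inf (ConflationBetween (rac_conf c1))) compm0).
  by exists e, h'.
have [ef [f' [df if']]] := lifts _ _ a b f.
have [eg [g' [dg ig]]] := lifts _ _ b a g.
have [v' ev] := la _ v XY.
(* The part of the chain homotopy that the factorization through Y provides is
   removed first; what is left lands in the syzygy. *)
have [w ew] : exists w,
    idm _ - eg \c ef - v' \c (u \c rac_def a) = rac_inf a \c w.
  apply: (@cinf_lift _ _ _ ca); rewrite /= !compBr compm1 compA dg -compA df.
  by rewrite (compA g) (compA _ v') -ev (compA v) -euv compBl comp1m subrr.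
exists f', g', (rac_mid a), (rac_inf a), w; split=> //.
apply: (@cinf_mono _ _ _ ca); rewrite /= [RHS]compA -ew !compBl !compBr.
rewrite comp1m compm1 -!compA if' (cdef_inf ca) !compm0 subr0.
by rewrite [in RHS]compA ig -compA.
Qed.

Lemma stable_retract_mem A B : stable_retract A B -> X B -> factors X (idm A).
Proof.
move=> [f [g fac]] XB.
have fgf : factors X (g \c f) by exists B, f, g.
have /idealP := fac; have /idealP := fgf => h1 h2.
by apply/idealP; have := rpredD h2 h1; rewrite subrK.
Qed.

Lemma iter_syzygy_factors n m A B :
  rigid_upto n -> (m <= n)%N -> stable_retract A B -> resolved m B ->
  factors X (idm (iter m down A)).
Proof.
move=> rigid; elim: m A B => [|m IH] A B mn sr.
  exact: stable_retract_mem sr.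
move=> [K [d [Xd rK]]]; rewrite iterSr.
have ap := resolved_right_approx rigid mn Xd rK.
apply: (IH _ K) => //; first exact: ltnW.
exact: (stable_retract_syzygy (c A) (RightApproxConflation (cconf d) ap)).
Qed.

(** The syzygies in a given resolution and the chosen iterated syzygies are
stable retracts of one another, because both come from right approximations; so
the [n]-th chosen syzygy is stably zero. *)
Lemma resolvedP n : rigid_upto n ->
  (forall A, resolved n A) <-> (forall A, factors X (idm (iter n down A))).
Proof.
move=> rigid; split=> h A; last first.
  exact/resolved_of_iter/(factors_right_approx_mem (c _))/h.
apply: (iter_syzygy_factors rigid (leqnn n) _ (h A)).
exists (idm A), (idm A); rewrite compm1 subrr.
by apply/idealP; exact: rpred0.
Qed.

End Syzygies.

End Resolutions.

Section ApproxConflation.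
Local Open Scope ring_scope.
Variables (E : exact_category) (X : add_subcat E).

(** The map from the sum of [Z] and [Y] to [A] given by [p] and [d] is again a
right approximation, and it is a deflation although [p] need not be one: it is
the composite of the pullback [q] of [d], which goes to the sum of [Z] and [A],
with the map given by [p] and the identity, which differs from the projection to
[A] by the automorphism [phi]. *)
Lemma generating_approx_conflation (A Y Z : E) (d : hom Y A) (p : hom Z A) :
  X Y -> deflation d -> right_approx X p ->
  inhabited (right_approx_conflation X A).
Proof.
move=> XY dd [XZ lft].
have [s [r [j [rs sj rj rsj]]]] := split_conflation Z A.
have [Q [f' [q [[e univ] dq]]]] := deflation_pullback (cdef s) dd.
have [|i1 [[fi1 qi1] _]] := univ Z 0 (cinf s); first by rewrite compm0 cdef_inf.
have XQ : X Q.
  apply: add_sum XZ XY.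
  have [|i2 [[fi2 qi2] _]] := univ Y (idm Y) (j \c d).
    by rewrite compm1 compA sj comp1m.
  exists i1, i2, (r \c q), f'; split=> //.
  - by rewrite -compA qi1.
  - by rewrite -compA qi2 compA rj comp0m.
  have [|t [_ ut]] := univ Q f' q; first by [].
  rewrite -(ut (idm Q)) ?compm1 // -(ut (i1 \c (r \c q) + i2 \c f')) //.
  split; first by rewrite compDr !compA fi1 fi2 !comp0m add0r comp1m.
  rewrite compDr !compA qi1 qi2 -(compA j) e compA -compDl.
  by rewrite rsj comp1m.
pose phi := idm (cmid s) + j \c (p \c r).
pose phi' := idm (cmid s) - j \c (p \c r).
have jprjpr : (j \c (p \c r)) \c (j \c (p \c r)) = 0.
  by rewrite -!compA (compA r) rj comp0m !compm0.
have phiK : phi' \c phi = idm _.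
  by rewrite compBl comp1m compDr compm1 jprjpr addr0 addrK.
have phiK' : phi \c phi' = idm _.
  by rewrite compBr compm1 compDl comp1m jprjpr addr0 addrK.
have dphi : deflation (cdef s \c phi).
  exists Z, (phi' \c cinf s).
  apply: (conflation_iso (a := idm Z) (b := phi') (d := idm A)) (cconf s);
    try exact: is_iso_idm.
  - by exists phi.
  - by rewrite compm1.
  - by rewrite comp1m -compA phiK' compm1.
have [K [v cf]] := deflation_comp dq dphi.
constructor; apply: RightApproxConflation cf _; split=> // W h XW.
have [a ea] := lft _ h XW.
exists (i1 \c a); rewrite ea -!compA (compA q) qi1 /phi !compDl !compDr comp1m.
rewrite compA cdef_inf comp0m add0r !compA sj comp1m.
by rewrite -!compA (compA r) rs comp1m.
Qed.

End ApproxConflation.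

(** * The stable category *)

Section NatIso.
Local Open Scope ring_scope.
Variables (E : exact_category) (X : add_subcat E).
Notation Q := (ideal_quotient X).

(** An object of the quotient category is zero exactly when its identity
factors through [X], and then naturality is automatic. *)
Lemma nat_iso_zero (F : functor Q Q) :
  nat_iso F (zero_functor X) <-> forall A : E, factors X (@idm E (F A)).
Proof.
split=> [[eta [iso _]] A|fac].
  have [g [h _]] := iso A; rewrite -[idm _]subr0; apply/qpiP.
  rewrite -[LHS]h /= /qcomp -[qrepr (eta A)]comp1m.
  by rewrite (zobjP E) comp0m compm0.
have qpi0 (A B : E) : qpi X (0 : hom A B) = 0 by rewrite /qpi raddf0.
have F0 (A : E) : @idm Q (F A) = 0.
  by rewrite -(qpi0 (F A) (F A)); apply/qpiP; rewrite subr0.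
have z0 : @idm Q (zobj E) = 0 by rewrite /= (zobjP E) qpi0.
exists (fun A => 0); split=> [A|A B f]; last by rewrite comp0m compm0.
by exists 0; rewrite !comp0m; split; rewrite ?F0.
Qed.

Lemma fobj_pow (C : preadditive) (F : functor C C) m (A : C) :
  functor_pow F m A = iter m F A.
Proof. by elim: m => //= m ->. Qed.

End NatIso.

(** * The equivalences on the side of resolutions *)

Section ResolutionSide.
Variables (E : exact_category) (X : add_subcat E) (n : nat).
Hypotheses (n_gt0 : 0 < n) (rigid : rigid_upto X n).

Lemma resolution_loop :
  (forall A : E, resolved X n A) <->
  (exists hX : strongly_contravariantly_finite X,
     nat_iso (functor_pow (loop hX) n) (zero_functor X)).
Proof.
have loopE hX : nat_iso (functor_pow (loop hX) n) (zero_functor X) <->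
    (forall A : E, resolved X n A).
  rewrite nat_iso_zero (resolvedP (fun A => inhabited_witness (hX A)) rigid).
  by split=> h A; move: (h A); rewrite fobj_pow.
split=> [res|[hX /loopE] //].
by exists (resolved_contravariantly_finite rigid n_gt0 res); apply/loopE.
Qed.

Lemma resolution_orthogonal : (forall A : E, resolved X n A) ->
  [/\ forall A : E, exists (XA : E) (p : hom XA A), right_approx X p,
      generating X
    & forall A : E, X A <->
        (forall B i, X B -> 1 <= i <= n -> Ext_vanishes i A B)].
Proof.
move=> res; have scf := resolved_contravariantly_finite rigid n_gt0 res.
split=> A.
- by have [a] := scf A; exists (rac_mid a), (rac_def a); exact: rac_approx.
- have [a] := scf A; exists (rac_mid a), (rac_def a).
  split; first by have [] := rac_approx a.
  by exists (syz a), (rac_inf a); exact: rac_conf.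
split=> [XA B i XB iN|]; first exact: rigid.
exact: resolved_ext_orthogonal.
Qed.

(** A right approximation alone need not be a deflation; generation turns it
into a right approximation conflation. *)
Lemma orthogonal_resolution :
  (forall A : E, exists (XA : E) (p : hom XA A), right_approx X p) ->
  generating X ->
  (forall A : E, (forall B i, X B -> 1 <= i <= n -> Ext_vanishes i B A) -> X A) ->
  forall A : E, resolved X n A.
Proof.
move=> approx gen; apply: resolved_of_approx => // A.
have [Y [d [XY dd]]] := gen A; have [Z [p ap]] := approx A.
exact: generating_approx_conflation XY dd ap.
Qed.

(** Injective objects are orthogonal to everything, so they lie in [X]. *)
Lemma injectives_cogenerating : enough_injectives E ->
  (forall A : E, (forall B i, X B -> 1 <= i <= n -> Ext_vanishes i B A) -> X A) ->
  cogenerating X.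
Proof.
move=> inj orth A; have [I [u [injI infl]]] := inj A.
exists I, u; split=> //; apply: orth => B [|i] // XB _.
exact: Ext_injective.
Qed.

End ResolutionSide.

(** * The side of coresolutions, by duality *)

Section CoresolutionSide.
Variables (E : exact_category) (X : add_subcat E).
Notation op := (dual E).
Notation Xop := (dual_subcat X).

Lemma has_coresolutionE m (A : E) :
  has_coresolution X m.+1 A <-> resolved Xop m.+1 A.
Proof.
rewrite /has_coresolution /=; elim: m A => [|m IH] A.
  split=> [[B [c [XB Xc]]]|[B [c [Xc XB]]]].
    by exists B, (dual_conf c).
  by exists B, (undual_conf c).
split=> [[B [[K [c s]] [XB [Xc Xs]]]]|[K [c [Xc]]]].
  by exists K, (dual_conf c); split=> //; apply/IH; exists B, s.
move=> /IH[B [s [XB Xs]]].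
by exists B, (admcons (undual_conf c) s).
Qed.

Lemma dual_rigid n : rigid_upto X n -> rigid_upto Xop n.
Proof. by move=> rigid i A B iN XA XB; apply/(@Ext_vanishes_dual E); exact: rigid. Qed.

Definition dual_approx_conflation (A : E) (a : left_approx_conflation X A) :
    right_approx_conflation Xop A :=
  @RightApproxConflation op Xop A (lac_mid a) (cosyz a) (lac_def a) (lac_inf a)
    (lac_conf a) (lac_approx a).

Definition undual_approx_conflation (A : E)
    (a : right_approx_conflation Xop A) : left_approx_conflation X A :=
  @LeftApproxConflation E X A (rac_mid a) (syz a) (rac_def a) (rac_inf a)
    (rac_conf a) (rac_approx a).

Lemma dual_factors (A B : E) (f : hom A B) :
  factors X f <-> @factors op Xop B A f.
Proof. by split=> -[Y [a [b [XY e]]]]; exists Y, b, a. Qed.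

Lemma coresolution_suspension n : 0 < n -> rigid_upto X n ->
  (forall A : E, resolved Xop n A) <->
  (exists hX : strongly_covariantly_finite X,
     nat_iso (functor_pow (suspension hX) n) (zero_functor X)).
Proof.
move=> n_gt0 /dual_rigid rigid.
have suspE hX : nat_iso (functor_pow (suspension hX) n) (zero_functor X) <->
    (forall A : E, resolved Xop n A).
  rewrite nat_iso_zero (@resolvedP op Xop
    (fun A => dual_approx_conflation (inhabited_witness (hX A))) n rigid).
  by split=> h A; move: (h A); rewrite fobj_pow => /dual_factors.
split=> [res|[hX /suspE] //].
have hX : strongly_covariantly_finite X.
  move=> A; have [a] := resolved_contravariantly_finite rigid n_gt0 res A.
  by constructor; exact: undual_approx_conflation.
by exists hX; apply/suspE.
Qed.

End CoresolutionSide.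

(** * The characterization of cluster tilting subcategories *)

Theorem proposition3p16 (n : nat) (n_gt0 : 1 <= n) (E : exact_category)
    (X : add_subcat E)
    (rigid : forall (i : nat) (A B : E), 1 <= i <= n -> X A -> X B ->
       Ext_vanishes i A B) :
  [/\ enough_projectives E -> enough_injectives E ->
        (cluster_tilting X n <->
         forall A : E, has_coresolution X n A /\ has_resolution X n A),
      (cluster_tilting X n /\ generating X /\ cogenerating X) <->
        (forall A : E, has_coresolution X n A /\ has_resolution X n A),
      (forall A : E, has_coresolution X n A) <->
        (exists hX : strongly_covariantly_finite X,
           nat_iso (functor_pow (suspension hX) n) (zero_functor X))
    & (forall A : E, has_resolution X n A) <->
        (exists hX : strongly_contravariantly_finite X,
           nat_iso (functor_pow (loop hX) n) (zero_functor X))].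
Proof.
have resE A : has_resolution X n A <-> resolved X n A.
  by rewrite -(prednK n_gt0); exact: has_resolutionE.
have coresE A : has_coresolution X n A <-> resolved (dual_subcat X) n A.
  by rewrite -(prednK n_gt0); exact: has_coresolutionE.
have rigid' := dual_rigid rigid.
have iff2 : (cluster_tilting X n /\ generating X /\ cogenerating X) <->
    (forall A : E, has_coresolution X n A /\ has_resolution X n A).
  split=> [[[[lap rap] orthl orthr] [gen cogen]] A|res].
    split.
      apply/coresE; apply: (@orthogonal_resolution (dual E)) => // {}A vA.
      apply/orthl => B i XB iN; apply/(@Ext_vanishes_dual E); exact: vA.
    by apply/resE; apply: orthogonal_resolution => // {}A /orthr.
  have [|rap gen orthl] := resolution_orthogonal n_gt0 rigid.
    by move=> A; apply/resE; case: (res A).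
  have [|lap cogen orthr] := resolution_orthogonal n_gt0 rigid'.
    by move=> A; apply/coresE; case: (res A).
  split; last by []; split=> // A.
  split=> [/orthr h B i XB iN|h].
    by apply/(@Ext_vanishes_dual E); exact: h.
  by apply/orthr => B i XB iN; apply/(@Ext_vanishes_dual E); exact: h.
split=> //.
- move=> proj inj; rewrite -iff2; split=> [ct|[]] //; split=> //.
  have [_ orthl orthr] := ct; split.
    suff cogen : cogenerating (dual_subcat X) by [].
    have inj' : enough_injectives (dual E).
      move=> A; have [P [p [projP dp]]] := proj A; exists P, p.
      by split=> // B D u; exact: projP.
    apply: (injectives_cogenerating (n := n) inj') => A vA.
    by apply/orthl => B i XB iN; apply/(@Ext_vanishes_dual E); exact: vA.
  by apply: (injectives_cogenerating (n := n) inj) => A /orthr.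
- rewrite -coresolution_suspension //.
  by split=> h A; apply/coresE.
- rewrite -resolution_loop //.
  by split=> h A; apply/resE.
Qed.
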